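(* Let $(b_\nu)_{\nu\in\mathbb{Z}_{\ge 0}^2}$ be a family of quaternions. Suppose that there are constants $r_0, M, N_0\in\mathbb{R}$ such that for all integers $n>N_0$ and all multi-indices $\nu=(s,t)\in\mathbb{Z}_{\ge 0}^2$ with $\|\nu\|=s+t=n$ we have $\|b_\nu\|\,r_0^n\le M$. Then the series $$g(x)=\sum_{n=0}^\infty\ \sum_{\substack{\nu=(s,t)\\ s+t=n}} S_\nu(x)\, b_\nu$$ converges compactly on $\{x\in\mathbb{V} : \|x\|_1'<r_0\}$.
   Context: $\mathbb{H}$ denotes the quaternions with imaginary units $i,j,k$ ($i^2=j^2=k^2=ijk=-1$) and Euclidean norm $\|\cdot\|$; $\mathbb{V}\subset\mathbb{H}$ is the real vector space spanned by $i,j,k$, with elements $v=iv_1+jv_2+kv_3$, $v_1,v_2,v_3\in\mathbb{R}$. Define $\xi_2,\xi_3:\mathbb{V}\to\mathbb{H}$ by $\xi_2(v)=v_2-i^{-1}j\,v_1$ and $\xi_3(v)=v_3-i^{-1}k\,v_1$. For $\nu=(s,t)\in\mathbb{Z}_{\ge0}^2$ put $\|\nu\|=s+t=n$, let $B_\nu$ be the set of all words $(i_1,\dots,i_n)$ with exactly $s$ letters $2$ and $t$ letters $3$, and define $$S_\nu(v)=\frac1{n!}\sum_{(i_1,\dots,i_n)\in B_\nu}\xi_{i_1}(v)\cdots\xi_{i_n}(v)$$ (the product over the empty word is $1$). The auxiliary norm on $\mathbb{V}$ is $\|iv_1+jv_2+kv_3\|_1'=\max\{\|v_2-i^{-1}jv_1\|,\|v_3-i^{-1}kv_1\|\}$.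 A series $\sum_n\sum_{\|\nu\|=n}S_\nu b_\nu$ converges compactly on an open set if its partial sums over $n\le N$ converge, as $N\to\infty$, uniformly on every compact subset of that set. *)

(* Defs.v *)
From HB Require Import structures.
From mathcomp Require Import all_boot all_order all_algebra ring lra.
From mathcomp Require Import all_classical all_reals all_analysis.

Set Implicit Arguments.
Unset Strict Implicit.
Unset Printing Implicit Defensive.

Import Order.TTheory GRing.Theory Num.Theory.
Import numFieldNormedType.Exports.

Local Open Scope classical_set_scope.
Local Open Scope ring_scope.

(* [Quaternion a b c d] is a + ib + jc + kd. *)
Record quaternion (R : Type) : Type :=
  Quaternion { qre : R; qim1 : R; qim2 : R; qim3 : R }.

Section QuaternionAlgebra.
Context {R : realType}.
Implicit Types x y z : quaternion R.

Let tuple_of_quaternion x := (qre x, qim1 x, qim2 x, qim3 x).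
Let quaternion_of_tuple (t : R * R * R * R) :=
  Quaternion t.1.1.1 t.1.1.2 t.1.2 t.2.
Let tuple_of_quaternionK : cancel tuple_of_quaternion quaternion_of_tuple.
Proof. by case. Qed.

HB.instance Definition _ :=
  Choice.copy (quaternion R) (can_type tuple_of_quaternionK).

Definition addq x y := Quaternion
  (qre x + qre y) (qim1 x + qim1 y) (qim2 x + qim2 y) (qim3 x + qim3 y).

Definition oppq x := Quaternion (- qre x) (- qim1 x) (- qim2 x) (- qim3 x).

Definition mulq x y := Quaternion
  (qre x * qre y - qim1 x * qim1 y - qim2 x * qim2 y - qim3 x * qim3 y)
  (qre x * qim1 y + qim1 x * qre y + qim2 x * qim3 y - qim3 x * qim2 y)
  (qre x * qim2 y - qim1 x * qim3 y + qim2 x * qre y + qim3 x * qim1 y)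
  (qre x * qim3 y + qim1 x * qim2 y - qim2 x * qim1 y + qim3 x * qre y).

Definition scaleq (a : R) x :=
  Quaternion (a * qre x) (a * qim1 x) (a * qim2 x) (a * qim3 x).

Definition normsq x := qre x ^+ 2 + qim1 x ^+ 2 + qim2 x ^+ 2 + qim3 x ^+ 2.

Definition normq x := Num.sqrt (normsq x).

Definition invq x :=
  if x == Quaternion 0 0 0 0 then x
  else scaleq (normsq x)^-1 (Quaternion (qre x) (- qim1 x) (- qim2 x) (- qim3 x)).

Let eqq a b c d a' b' c' d' :
  a = a' -> b = b' -> c = c' -> d = d' ->
  Quaternion a b c d = Quaternion a' b' c' d' :> quaternion R.
Proof. by move=> -> -> -> ->. Qed.

Let addqA : associative addq.
Proof. by move=> x y z; apply: eqq => /=; ring. Qed.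
Let addqC : commutative addq.
Proof. by move=> x y; apply: eqq => /=; ring. Qed.
Let add0q : left_id (Quaternion 0 0 0 0) addq.
Proof. by case=> a b c d; apply: eqq => /=; ring. Qed.
Let addNq : left_inverse (Quaternion 0 0 0 0) oppq addq.
Proof. by move=> x; apply: eqq => /=; ring. Qed.

HB.instance Definition _ :=
  GRing.isZmodule.Build (quaternion R) addqA addqC add0q addNq.

Let mulqA : associative mulq.
Proof. by move=> x y z; apply: eqq => /=; ring. Qed.
Let mul1q : left_id (Quaternion 1 0 0 0) mulq.
Proof. by case=> a b c d; apply: eqq => /=; ring. Qed.
Let mulq1 : right_id (Quaternion 1 0 0 0) mulq.
Proof. by case=> a b c d; apply: eqq => /=; ring. Qed.
Let mulqDl : left_distributive mulq +%R.
Proof. by move=> x y z; apply: eqq => /=; ring. Qed.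
Let mulqDr : right_distributive mulq +%R.
Proof. by move=> x y z; apply: eqq => /=; ring. Qed.
Let oneq_neq0 : Quaternion 1 0 0 0 != 0 :> quaternion R.
Proof. by apply/eqP => -[] /eqP; rewrite oner_eq0. Qed.

HB.instance Definition _ := GRing.Zmodule_isNzRing.Build (quaternion R)
  mulqA mul1q mulq1 mulqDl mulqDr oneq_neq0.

Let scaleqA a b x : scaleq a (scaleq b x) = scaleq (a * b) x.
Proof. by apply: eqq => /=; ring. Qed.
Let scale1q : left_id 1 scaleq.
Proof. by case=> a b c d; apply: eqq => /=; ring. Qed.
Let scaleqDr : right_distributive scaleq +%R.
Proof. by move=> a x y; apply: eqq => /=; ring. Qed.
Let scaleqDl x : {morph scaleq^~ x : a b / a + b}.
Proof. by move=> a b; apply: eqq => /=; ring. Qed.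

HB.instance Definition _ := GRing.Zmodule_isLmodule.Build R (quaternion R)
  scaleqA scale1q scaleqDr scaleqDl.

Let scaleqAl (a : R) x y : a *: (x * y) = (a *: x) * y.
Proof. by apply: eqq => /=; ring. Qed.
Let scaleqAr (a : R) x y : a *: (x * y) = x * (a *: y).
Proof. by apply: eqq => /=; ring. Qed.

HB.instance Definition _ :=
  GRing.Lmodule_isLalgebra.Build R (quaternion R) scaleqAl.
HB.instance Definition _ :=
  GRing.Lalgebra_isAlgebra.Build R (quaternion R) scaleqAr.

Let normsq_eq0 x : normsq x = 0 -> x = 0.
Proof.
case: x => a b c d; rewrite /normsq /= => /eqP.
rewrite !paddr_eq0 ?addr_ge0 ?sqr_ge0// !sqrf_eq0.
by move=> /andP[/andP[/andP[/eqP-> /eqP->] /eqP->] /eqP->].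
Qed.

Let mulVq : {in [pred x | x != 0], left_inverse 1 invq *%R}.
Proof.
move=> x; rewrite inE => x0; rewrite /invq.
case: ifPn => [|_]; first by rewrite (negPf x0).
have : normsq x != 0 by apply: contraNN x0 => /eqP/normsq_eq0->.
by rewrite /normsq => n0; apply: eqq => /=; field.
Qed.
Let mulqV : {in [pred x | x != 0], right_inverse 1 invq *%R}.
Proof.
move=> x; rewrite inE => x0; rewrite /invq.
case: ifPn => [|_]; first by rewrite (negPf x0).
have : normsq x != 0 by apply: contraNN x0 => /eqP/normsq_eq0->.
by rewrite /normsq => n0; apply: eqq => /=; field.
Qed.
Let unitqP x y : y * x = 1 /\ x * y = 1 -> x != 0.
Proof. by case=> yx _; apply/eqP => x0; have /eqP := yx; rewrite x0 mulr0 eq_sym oner_eq0. Qed.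
Let invq_out : {in [predC [pred x | x != 0]], invq =1 id}.
Proof. by move=> x; rewrite !inE negbK => /eqP ->; rewrite /invq eqxx. Qed.

HB.instance Definition _ := GRing.NzRing_hasMulInverse.Build (quaternion R)
  mulVq mulqV unitqP invq_out.

Let normsq_ge0 x : 0 <= normsq x.
Proof. by rewrite /normsq !addr_ge0 ?sqr_ge0. Qed.

Let ler_normqD x y : normq (x + y) <= normq x + normq y.
Proof.
rewrite -(@ler_pXn2r _ 2) ?nnegrE ?addr_ge0 ?sqrtr_ge0//.
rewrite sqrrD !sqr_sqrtr ?normsq_ge0// /normq -sqrtrM ?normsq_ge0//.
set p := qre x * qre y + qim1 x * qim1 y + qim2 x * qim2 y + qim3 x * qim3 y.
suff : p <= Num.sqrt (normsq x * normsq y).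
  by rewrite /normsq /p /=; move: (Num.sqrt _) => s ps; lra.
rewrite (le_trans (ler_norm p))// -sqrtr_sqr ler_wsqrtr//.
have -> : normsq x * normsq y = p ^+ 2 +
    (qre x * qim1 y - qim1 x * qre y) ^+ 2 +
    (qre x * qim2 y - qim2 x * qre y) ^+ 2 +
    (qre x * qim3 y - qim3 x * qre y) ^+ 2 +
    (qim1 x * qim2 y - qim2 x * qim1 y) ^+ 2 +
    (qim1 x * qim3 y - qim3 x * qim1 y) ^+ 2 +
    (qim2 x * qim3 y - qim3 x * qim2 y) ^+ 2 by rewrite /normsq /p; ring.
by rewrite -!addrA lerDl !addr_ge0 ?sqr_ge0.
Qed.

Let normqZ (a : R) x : normq (a *: x) = `|a| * normq x.
Proof.
rewrite -sqrtr_sqr /normq -sqrtrM ?sqr_ge0//; congr Num.sqrt.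
by rewrite /normsq /=; ring.
Qed.

Let normq_eq0 x : normq x = 0 -> x = 0.
Proof.
move=> /eqP; rewrite sqrtr_eq0 => x0; apply: normsq_eq0.
by apply/eqP; rewrite eq_le x0 normsq_ge0.
Qed.

HB.instance Definition _ := Lmodule_isNormed.Build R (quaternion R)
  ler_normqD normqZ normq_eq0.

End QuaternionAlgebra.

Section FueterSeries.
Context {R : realType}.
Notation H := (quaternion R).

Definition qi : H := Quaternion 0 1 0 0.
Definition qj : H := Quaternion 0 0 1 0.
Definition qk : H := Quaternion 0 0 0 1.

Definition pure_quaternions : set H :=
  [set v : H | exists v1 v2 v3 : R, v = v1 *: qi + v2 *: qj + v3 *: qk].

(* The next functions are only meant on [pure_quaternions]; elsewhere they
   disregard the real part of their argument. *)
Definition xi2 (v : H) : H := (qim2 v)%:A - qi^-1 * qj * (qim1 v)%:A.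
Definition xi3 (v : H) : H := (qim3 v)%:A - qi^-1 * qk * (qim1 v)%:A.

(* The letters 2 and 3 of words are encoded as [false] and [true]. *)
Definition xi (l : bool) : H -> H := if l then xi3 else xi2.

Definition words (s t : nat) : {set (s + t).-tuple bool} :=
  [set w : (s + t).-tuple bool |
    (count_mem false w == s) && (count_mem true w == t)]%SET.

Definition fueterS (s t : nat) (v : H) : H :=
  ((s + t)`!%:R : R)^-1 *: \sum_(w in words s t) \prod_(l <- w) xi l v.

Definition norm1' (v : H) : R :=
  Num.max `|(qim2 v)%:A - qi^-1 * qj * (qim1 v)%:A|
          `|(qim3 v)%:A - qi^-1 * qk * (qim1 v)%:A|.

(* The multi-indices (s, t) with s + t = n are the pairs (s, n - s), s <= n. *)
Definition fueter_partial_sum (b : nat -> nat -> H) (N : nat) (v : H) : H :=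
  \sum_(n < N.+1) \sum_(s < n.+1) fueterS s (n - s) v * b s (n - s)%N.

End FueterSeries.

(* Compactness of K does not depend on the ambient space, so for A inside a
   subspace V of T this is compact convergence for the topology of V. *)
Definition converges_compactly (T : topologicalType) (E : uniformType)
    (u : nat -> T -> E) (A : set T) : Prop :=
  exists g : T -> E, forall K : set T, compact K -> K `<=` A ->
    {uniform K, u @ \oo --> g}.

(* Main.v *)
From HB Require Import structures.
Require Import Defs.
From mathcomp Require Import all_boot all_order all_algebra ring.
From mathcomp Require Import all_classical all_reals all_analysis.
Import Order.TTheory GRing.Theory Num.Theory.
Import numFieldNormedType.Exports.
Local Open Scope classical_set_scope.
Local Open Scope ring_scope.

(* On [norm1' x < r0] each product of n factors [xi] has norm at most r0^n, and
   there are 2^n words of length n, so the hypothesis on b bounds the n-th term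
   by M (n + 1) 2^n / n! <= M 4^n / n! for n > N0. By the Weierstrass test the
   convergence is uniform on the whole domain. *)

Section QuaternionNorm.
Context {R : realType}.
Implicit Types x y : quaternion R.

Lemma quaternion_normE x : `|x| = Num.sqrt (normsq x) :> R.
Proof. by []. Qed.

(** Euler's four-square identity, checked by [ring] on [normsq]. *)
Lemma quaternion_normM x y : `|x * y| = `|x| * `|y| :> R.
Proof.
rewrite !quaternion_normE -sqrtrM ?addr_ge0 ?sqr_ge0//; congr Num.sqrt.
by rewrite /normsq /=; ring.
Qed.

Lemma quaternion_norm1 : `|1 : quaternion R| = 1 :> R.
Proof. by rewrite quaternion_normE /normsq /= expr0n expr1n/= !addr0 sqrtr1. Qed.

Lemma qre_norm x : `|qre x| <= `|x|.
Proof.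
rewrite quaternion_normE -sqrtr_sqr ler_wsqrtr// /normsq -!addrA lerDl.
by rewrite !addr_ge0 ?sqr_ge0.
Qed.

Lemma qim1_norm x : `|qim1 x| <= `|x|.
Proof.
rewrite quaternion_normE -sqrtr_sqr ler_wsqrtr// /normsq.
by rewrite -!addrA addrCA lerDl !addr_ge0 ?sqr_ge0.
Qed.

Lemma qim2_norm x : `|qim2 x| <= `|x|.
Proof.
rewrite quaternion_normE -sqrtr_sqr ler_wsqrtr// /normsq.
by rewrite addrAC lerDr !addr_ge0 ?sqr_ge0.
Qed.

Lemma qim3_norm x : `|qim3 x| <= `|x|.
Proof.
rewrite quaternion_normE -sqrtr_sqr ler_wsqrtr// /normsq.
by rewrite lerDr !addr_ge0 ?sqr_ge0.
Qed.

(** Converse to the four coordinate bounds: iterating a^2 + b^2 <= (a + b)^2 for nonnegative a, b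
    absorbs one coordinate at a time. *)
Lemma quaternion_norm_le x :
  `|x| <= `|qre x| + `|qim1 x| + `|qim2 x| + `|qim3 x|.
Proof.
rewrite quaternion_normE -[leRHS]ger0_norm ?addr_ge0// -sqrtr_sqr ler_wsqrtr//.
rewrite /normsq -(real_normK (num_real (qre x))) -(real_normK (num_real (qim1 x))).
rewrite -(real_normK (num_real (qim2 x))) -(real_normK (num_real (qim3 x))).
have sqrD (a b : R) : 0 <= a -> 0 <= b -> a ^+ 2 + b ^+ 2 <= (a + b) ^+ 2.
  by move=> a0 b0; rewrite sqrrD lerD2r lerDl mulrn_wge0// mulr_ge0.
do 2 (apply: le_trans (sqrD _ _ _ _); rewrite ?addr_ge0// lerD2r).
exact: sqrD.
Qed.

(** Each coordinate is 1-Lipschitz, so it maps a Cauchy filter to a Cauchy filter on the reals. The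
    four limits form the limit quaternion, each coordinate contributing e / 4 to the error.
    Completeness is what the Weierstrass test asks of the target space. *)
Lemma quaternion_complete (F : set_system (quaternion R)) :
  ProperFilter F -> cauchy F -> cvg F.
Proof.
move=> FF Fc; have /cauchyP Fex := Fc.
have coord (p : quaternion R -> R) : (forall x y, `|p x - p y| <= `|x - y|) ->
    cvg (p @ F).
  move=> p_le; apply/cauchy_cvgP/cauchyP => e /Fex[x Fx].
  exists (p x); have := Fx; apply: (@filterS _ F) => y; rewrite /= -!ball_normE /=.
  exact: le_lt_trans.
have /cvg_ex[/= a Fa] : cvg (@qre R @ F).
  by apply: coord => x y; exact: (qre_norm (x - y)).
have /cvg_ex[/= b Fb] : cvg (@qim1 R @ F).
  by apply: coord => x y; exact: (qim1_norm (x - y)).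
have /cvg_ex[/= c Fc'] : cvg (@qim2 R @ F).
  by apply: coord => x y; exact: (qim2_norm (x - y)).
have /cvg_ex[/= d Fd] : cvg (@qim3 R @ F).
  by apply: coord => x y; exact: (qim3_norm (x - y)).
apply/cvg_ex; exists (Quaternion a b c d); apply/cvgrPdist_lt => e e0.
have e4 : 0 < e / 4 by rewrite divr_gt0.
move/cvgrPdist_lt : Fa => /(_ _ e4) Fa; move/cvgrPdist_lt : Fb => /(_ _ e4) Fb.
move/cvgrPdist_lt : Fc' => /(_ _ e4) Fc'; move/cvgrPdist_lt : Fd => /(_ _ e4) Fd.
near=> x; apply: le_lt_trans (quaternion_norm_le _) _ => /=.
rewrite (_ : e = e / 4 + e / 4 + e / 4 + e / 4); last by field.
by rewrite !ltrD//; near: x.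
Unshelve. all: by end_near. Qed.

HB.instance Definition _ :=
  Uniform_isComplete.Build (quaternion R) quaternion_complete.

End QuaternionNorm.

(** The majorant is only required eventually, to match a bound on the coefficients that holds only
    for n > N0. The Cauchy criterion for [series m] gives one for the functions that is uniform on
    [A]. *)
Lemma weierstrass_M_test (R : realType) (T : choiceType)
    (V : completeNormedModType R) (f : nat -> T -> V) (m : nat -> R) (A : set T) :
  (\forall n \near \oo, forall x, A x -> `|f n x| <= m n) ->
  cvgn (series m) ->
  exists g : T -> V, {uniform A, (fun n x => series (f ^~ x) n) @ \oo --> g}.
Proof.
move=> [n0 _ fm] /cauchy_cvgP/cauchy_seriesP mc.
have tail e : 0 < e -> exists N, forall i j x, (N <= i)%N -> (N <= j)%N ->
    A x -> `|\sum_(i <= k < j) f k x| < e.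
  move=> /mc[[P Q] /= [[i1 _ Pi] [i2 _ Qi]] mce].
  (* [n0] makes the majorant valid; [i1] and [i2] put the pair [(i, j)] in the product neighbourhood
     supplied by the Cauchy criterion. *)
  exists (maxn n0 (maxn i1 i2)) => i j x.
  rewrite !geq_max => /and3P[n0i i1i _] /and3P[_ _ i2j] Ax.
  apply: le_lt_trans (mce (i, j) (conj (Pi _ i1i) (Qi _ i2j))).
  apply: le_trans (ler_norm _); apply: le_trans (ler_norm_sum _ _ _) _.
  rewrite !big_nat; apply: ler_sum => k /andP[ik _]; apply: fm => //=.
  exact: leq_trans ik.
have fc x : A x -> cvgn (series (f ^~ x)).
  move=> Ax; apply/cauchy_cvgP/cauchy_seriesP => e /tail[N Ne].
  exists ([set k | (N <= k)%N], [set k | (N <= k)%N]) => /=.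
    by split; exists N.
  by move=> [i j] /= [Ni Nj]; exact: Ne.
(* Outside [A] this may be a default value of [limn]; only points of [A] are compared. *)
exists (fun x => limn (series (f ^~ x))) => P /uniform_nbhs[E [+ EP]].
rewrite -entourage_ballE => -[e /= e0 eE].
have e2 : 0 < e / 2 by rewrite divr_gt0.
have [N Ne] := tail _ e2.
exists N => // n /= Nn; apply: EP => x Ax; apply: eE => /=.
rewrite -ball_normE /=.
move/cvgrPdist_lt : (fc _ Ax) => /(_ _ e2) [k _ kP].
(* [k] depends on [x] but [N] does not. At index [maxn n k] the partial sum is within e / 2 of its
   limit, and [Ne] bounds the block from [n] to there by e / 2. *)
have [nk kk] := (leq_maxl n k, leq_maxr n k).
rewrite (splitr e).
rewrite -(subrKA (series (f ^~ x) (maxn n k))); apply: le_lt_trans (ler_normD _ _) _.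
rewrite ltrD//; first exact: kP.
by rewrite sub_series nk Ne// (leq_trans Nn).
Qed.

Section FueterTerm.
Context {R : realType}.
Notation H := (quaternion R).

Lemma xi_norm (l : bool) (v : H) : `|xi l v| <= norm1' v.
Proof. by rewrite /norm1' le_max; case: l; rewrite lexx ?orbT. Qed.

Lemma prod_xi_norm (w : seq bool) (v : H) :
  `|\prod_(l <- w) xi l v| <= norm1' v ^+ size w.
Proof.
elim: w => [|l w IH]; first by rewrite big_nil quaternion_norm1.
by rewrite big_cons quaternion_normM exprS ler_pM ?xi_norm.
Qed.

(** Here [exp_coeff a n] is a^n / n!. The factor 2^(s + t) counts all boolean words of that length,
    which include those of [words s t]. *)
Lemma fueterS_norm (s t : nat) (v : H) :
  `|fueterS s t v| <= exp_coeff (2 * norm1' v) (s + t)%N.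
Proof.
rewrite /fueterS normrZ ger0_norm ?invr_ge0// /exp_coeff /= mulrC.
apply: ler_wpM2r; first by rewrite invr_ge0.
apply: le_trans (ler_norm_sum _ _ _) _.
apply: (@le_trans _ _ (\sum_(w in words s t) norm1' v ^+ (s + t))).
  by apply: ler_sum => w _; rewrite -[in leRHS](size_tuple w) prod_xi_norm.
rewrite sumr_const -[leLHS]mulr_natl exprMn; apply: ler_wpM2r.
  by rewrite exprn_ge0// (le_trans (normr_ge0 _) (xi_norm true v)).
by rewrite -natrX ler_nat -card_bool -card_tuple max_card.
Qed.

Lemma fueter_term_norm (b : nat -> nat -> H) (r M : R) (n : nat) (v : H) :
  (forall s t, (s + t)%N = n -> `|b s t| * r ^+ n <= M) -> norm1' v < r ->
  `|\sum_(s < n.+1) fueterS s (n - s) v * b s (n - s)%N| <= M * exp_coeff 4 n.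
Proof.
move=> bM vr; have v0 : 0 <= norm1' v.
  exact: le_trans (normr_ge0 _) (xi_norm true v).
(* Instance s = n, t = 0 of [bM]; [r] is positive because it exceeds [norm1' v]. *)
have M0 : 0 <= M.
  by apply: le_trans (bM n 0%N (addn0 n)); rewrite mulr_ge0// exprn_ge0// ltW// (le_lt_trans v0).
apply: le_trans (ler_norm_sum _ _ _) _.
apply: (@le_trans _ _ (\sum_(s < n.+1) M * exp_coeff 2 n)).
  apply: ler_sum => s _; have sn : (s + (n - s))%N = n.
    by rewrite subnKC// -ltnS.
  rewrite quaternion_normM.
  apply: le_trans (ler_wpM2r _ (fueterS_norm _ _ _)) _ => //.
  rewrite sn /exp_coeff /= exprMn mulrAC mulrA; apply: ler_wpM2r.
    by rewrite invr_ge0.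
  (* With 2^n set aside, what remains is norm1'(v)^n |b| <= r^n |b| <= M. *)
  rewrite -mulrA mulrC; apply: ler_wpM2r; first by rewrite exprn_ge0.
  apply: le_trans (bM s (n - s)%N sn); rewrite mulrC; apply: ler_wpM2l => //.
  by apply: lerXn2r; rewrite ?nnegrE// ?ltW// (le_lt_trans v0).
rewrite sumr_const card_ord -mulrnAr; apply: ler_wpM2l => //.
rewrite /exp_coeff /= -[leLHS]mulr_natl mulrA; apply: ler_wpM2r.
  by rewrite invr_ge0.
(* The n + 1 summands are absorbed by n + 1 <= 2^n, whence 4^n = 2^n 2^n. *)
by rewrite -!natrX -natrM ler_nat (expnMn 2 2) leq_mul2r ltn_expl ?orbT.
Qed.

End FueterTerm.

Theorem theorem6p0p2 (R : realType) (b : nat -> nat -> quaternion R)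
    (r0 M N0 : R)
    (hb : forall n : nat, N0 < n%:R ->
          forall s t : nat, (s + t)%N = n -> `|b s t| * r0 ^+ n <= M) :
  converges_compactly (fueter_partial_sum b)
    [set x | pure_quaternions x /\ norm1' x < r0].
Proof.
pose A := [set x : quaternion R | pure_quaternions x /\ norm1' x < r0].
pose f n x := \sum_(s < n.+1) fueterS s (n - s) x * b s (n - s)%N.
have fM : \forall n \near \oo, forall x, A x -> `|f n x| <= (M *: exp_coeff 4) n.
  near=> n => x [_ xr]; apply: fueter_term_norm xr; apply: hb.
  by near: n; exact: nbhs_infty_gtr.
have Mexp : cvgn (series (M *: exp_coeff 4)).
  by apply: is_cvg_seriesZ; exact: is_cvg_series_exp_coeff.
have [g gP] := weierstrass_M_test _ _ _ _ _ _ fM Mexp.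
exists g => K _ KA; apply: uniform_subset_cvg KA _ => P /gP[N _ NP].
(* Index shift: [series] at n.+1 sums the terms 0 to n, as [fueter_partial_sum b n] does. *)
exists N => // n Nn; have := NP n.+1 (leqW Nn).
congr P; apply/funext => x; rewrite /fueter_partial_sum /series /=.
by rewrite big_mkord.
Unshelve. all: by end_near. Qed.
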